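(* Let $G$ be a finite Abelian group and let $A\subset G$ be a spectral set in $G$ with $|A|\le 5$. Then $A$ tiles $G$ by translation.
   Context: For a finite Abelian group $G$, a set $A\subseteq G$ is called spectral if there exists a set $\Lambda$ of characters of $G$ which forms an orthogonal basis of the space $L^2(A)$ of complex functions on $A$ (with counting measure, i.e. $\sum_{a\in A}\lambda(a)\overline{\lambda'(a)}=0$ for distinct $\lambda,\lambda'\in\Lambda$, and $|\Lambda|=|A|$); such $\Lambda$ is called a spectrum of $A$. The set $A$ tiles $G$ by translation if there exists $T\subseteq G$ such that $\sum_{t\in T}\chi_A(x-t)=1$ for all $x\in G$, i.e. every element of $G$ is uniquely of the form $a+t$ with $a\in A$, $t\in T$. *)

(* Defs.v *)
From mathcomp Require Import all_boot all_order all_algebra all_field.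
Set Implicit Arguments. Unset Strict Implicit. Unset Printing Implicit Defensive.
Import GRing.Theory Num.Theory.
Local Open Scope ring_scope.

Definition is_character (G : finZmodType) (chi : {ffun G -> algC}) : Prop :=
  chi 0 = 1 /\ forall x y : G, chi (x + y) = chi x * chi y.

Definition innerA (G : finZmodType) (A : {set G}) (f g : {ffun G -> algC}) : algC :=
  \sum_(a in A) f a * (g a)^*.

Definition is_spectrum (G : finZmodType) (A : {set G}) (L : seq {ffun G -> algC}) : Prop :=
  [/\ uniq L, size L = #|A|,
      (forall l, l \in L -> is_character l) &
      (forall l l', l \in L -> l' \in L -> l != l' -> innerA A l l' = 0)].

Definition spectral (G : finZmodType) (A : {set G}) : Prop :=
  exists L : seq {ffun G -> algC}, is_spectrum A L.

Definition tiles (G : finZmodType) (A : {set G}) : Prop :=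
  exists T : {set G}, forall x : G, (\sum_(t in T) (nat_of_bool ((x - t)%R \in A)))%N = 1%N.

(* Main.v *)
(* The characters of a spectrum, restricted to A, form a complex Hadamard matrix
   of order |A| <= 5 whose entries are roots of unity.  If the quotient of two
   rows runs through a coset of the |A|-th roots of unity, a fundamental domain
   of the power map pulls back to a complement of A.  This is immediate for
   |A| <= 3.  For |A| = 4, four unimodular numbers of sum 0 form two opposite
   pairs, and comparing the pairings of the rows yields two characters that
   together split A twice by signs.  For |A| = 5, Galois conjugation shows that
   five roots of unity of sum 0 either form a coset of the fifth roots of unity
   or contain an opposite pair, the rest being a coset of the cube roots of
   unity.  If all quotients of rows were of the second kind, the opposite pairs
   attached to the quotients by a fixed row would be distinct 2-sets, any two of
   which meet.  If u is the quotient with pair {a, s} and {s, b} is another pair,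
   then u_a ^ 2 = - u_b ^ 2, which determines b; so the three pairs other than
   {a, s} all lie in {{a, b}, {s, b}} and two of them coincide. *)
Require Import Defs.
From mathcomp Require Import all_boot all_order all_algebra all_field.
From mathcomp Require Import ring zify.
Set Implicit Arguments. Unset Strict Implicit. Unset Printing Implicit Defensive.
Import Order.TTheory GRing.Theory Num.Theory.
Local Open Scope ring_scope.

(** * Vanishing sums of roots of unity *)

Lemma neq0_of_expr1 (F : fieldType) (x : F) n : (0 < n)%N -> x ^+ n = 1 -> x != 0.
Proof.
move=> n0 xn; apply/eqP => x0; move: xn.
by rewrite x0 expr0n eqn0Ngt n0 /= => /esym/eqP; rewrite oner_eq0.
Qed.

Lemma normC_expr1 (x : algC) n : (0 < n)%N -> x ^+ n = 1 -> `|x| = 1.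
Proof.
move=> n0 xn; apply/eqP; rewrite -(@pexpr_eq1 _ `|x| n) //.
by rewrite -normrX xn normr1.
Qed.

(** Some automorphism of [algC] raises every [N]-th root of unity to the power [k]; apply it to the
    vanishing sum. *)
Lemma sum_expr_galois (I : finType) (z : I -> algC) N k :
  coprime k N -> (forall i, z i ^+ N = 1) -> \sum_i z i = 0 ->
  \sum_i z i ^+ k = 0.
Proof.
move=> kN zN s0; have [u uP] := Qn_aut_exists kN.
rewrite (eq_bigr (fun i => u (z i))) => [|i _]; last by rewrite uP.
by rewrite -rmorph_sum s0 rmorph0.
Qed.

Lemma sum_expr_unity (p : nat) (x : algC) :
  x ^+ p = 1 -> \sum_(j < p) x ^+ j = if x == 1 then p%:R else 0.
Proof.
move=> xp; case: eqP => [->|/eqP x1].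
  under eq_bigr do rewrite expr1n.
  by rewrite sumr_const card_ord.
have := subrX1 x p; rewrite xp subrr => /esym/eqP.
by rewrite mulf_eq0 subr_eq0 (negPf x1) /= => /eqP.
Qed.

(** Fourier inversion on the group of [p]-th roots of unity: the powers of [a i / x] sum to [p] when
    [a i = x] and to 0 otherwise. *)
Lemma sum_fiber (I : finType) (a w : I -> algC) p (x : algC) :
  (0 < p)%N -> (forall i, a i ^+ p = 1) -> x ^+ p = 1 ->
  p%:R * \sum_(i | a i == x) w i =
  \sum_(j < p) x ^- j * \sum_i a i ^+ j * w i.
Proof.
move=> p0 ap xp.
have x0 := neq0_of_expr1 p0 xp.
under [RHS]eq_bigr do rewrite mulr_sumr.
rewrite exchange_big /= mulr_sumr big_mkcond /=.
apply: eq_bigr => i _.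
have -> : \sum_(j < p) x ^- j * (a i ^+ j * w i)
        = (\sum_(j < p) (a i / x) ^+ j) * w i.
  rewrite mulr_suml; apply: eq_bigr => j _.
  by rewrite exprMn exprVn mulrA [x ^- j * _]mulrC.
rewrite sum_expr_unity; last by rewrite exprMn ap exprVn xp invr1 mulr1.
have -> : (a i / x == 1) = (a i == x).
  by rewrite -(inj_eq (mulIf x0)) mulfVK // mul1r.
by case: ifP; rewrite ?mul0r.
Qed.

(** The Fourier expansion of the fiber sum involves only the power sums of exponent [M * j + 1]. As
    [p] divides [M], this exponent is prime to [p * M], so each of them is a Galois conjugate of
    0. *)
Lemma sum_fiber_square (I : finType) (z : I -> algC) p M (x : algC) :
  (0 < p)%N -> (0 < M)%N -> (p %| M)%N ->
  (forall i, z i ^+ (p * M) = 1) -> \sum_i z i = 0 -> x ^+ p = 1 ->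
  \sum_(i | z i ^+ M == x) z i = 0.
Proof.
move=> p0 M0 pM zN s0 xp.
apply: (@mulfI _ p%:R); first by rewrite pnatr_eq0 -lt0n.
rewrite mulr0 (@sum_fiber _ (fun i => z i ^+ M)) //; last first.
  by move=> i; rewrite -exprM mulnC.
apply: big1 => j _.
suff -> : \sum_i (z i ^+ M) ^+ j * z i = 0 by rewrite mulr0.
under eq_bigr do rewrite -exprM -exprSr.
apply: (@sum_expr_galois _ _ (p * M)) => //.
have cM : coprime (M * j).+1 M.
  by rewrite -coprime_modl -addn1 -modnDml modnMr add0n coprime_modl coprime1n.
by rewrite coprimeMr cM (coprime_dvdr pM cM).
Qed.

(** By the Chinese remainder theorem each root splits into a [p]-th root and an [M]-th root. In the
    Fourier expansion of a fiber sum every term with [j] nonzero is a Galois conjugate of 0, and the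
    term [j = 0] does not depend on the fiber. *)
Lemma sum_fiber_coprime (I : finType) (z : I -> algC) p M :
  prime p -> (0 < M)%N -> coprime p M ->
  (forall i, z i ^+ (p * M) = 1) -> \sum_i z i = 0 ->
  exists a w : I -> algC,
  [/\ forall i, z i = a i * w i, forall i, a i ^+ p = 1, forall i, w i ^+ M = 1
    & forall x y, x ^+ p = 1 -> y ^+ p = 1 ->
      \sum_(i | a i == x) w i = \sum_(i | a i == y) w i].
Proof.
move=> pp M0 pM zN s0; have p0 := prime_gt0 pp.
(* The exponents [s] and [t] are the idempotents of Z/p x Z/M: they project a root of unity to its
   two components. *)
pose s := chinese p M 1 0; pose t := chinese p M 0 1.
have sp : s = 1 %[mod p] by apply: chinese_modl.
have sM : s = 0 %[mod M] by apply: chinese_modr.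
have tp : t = 0 %[mod p] by apply: chinese_modl.
have tM : t = 1 %[mod M] by apply: chinese_modr.
have Ms : (M %| s)%N by rewrite /dvdn sM mod0n.
have pt : (p %| t)%N by rewrite /dvdn tp mod0n.
exists (fun i => z i ^+ s), (fun i => z i ^+ t); split.
- move=> i; rewrite -exprD -(expr_mod _ (zN i)).
  suff -> : (s + t = 1 %[mod p * M])%N by rewrite (expr_mod _ (zN i)).
  apply/eqP; rewrite chinese_remainder // -modnDm sp tp -(modnDm s) sM tM.
  by rewrite !modnDm !eqxx.
- move=> i; rewrite -exprM; case/dvdnP: Ms => q ->.
  by rewrite -mulnA [(M * p)%N]mulnC mulnC exprM zN expr1n.
- move=> i; rewrite -exprM; case/dvdnP: pt => q ->.
  by rewrite -mulnA mulnC exprM zN expr1n.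
have key x : x ^+ p = 1 ->
    p%:R * \sum_(i | z i ^+ s == x) z i ^+ t = \sum_i z i ^+ t.
  move=> xp; rewrite (@sum_fiber _ (fun i => z i ^+ s)) //; last first.
    move=> i; rewrite -exprM; case/dvdnP: Ms => q ->.
    by rewrite -mulnA [(M * p)%N]mulnC mulnC exprM zN expr1n.
  case: p p0 {xp} pp pM zN @s @t sp sM tp tM Ms pt => // p p0 pp pM zN s t sp sM tp tM Ms pt.
  rewrite big_ord_recl /= expr0 invr1 mul1r [X in _ + X]big1 ?addr0; last first.
    (* The exponent [s * (j + 1) + t] is [j + 1] modulo [p] and 1 modulo [M], hence prime to
       [p * M]. *)
    move=> j _; rewrite /bump add1n.
    suff -> : \sum_i (z i ^+ s) ^+ j.+1 * z i ^+ t = 0 by rewrite mulr0.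
    under eq_bigr do rewrite -exprM -exprD.
    apply: (@sum_expr_galois _ _ (p.+1 * M)) => //.
    rewrite coprimeMr -coprime_modl -modnDm -modnMml sp modnMml mul1n tp modnDm addn0.
    rewrite coprime_modl -coprime_modl.
    rewrite -[X in _ && X]coprime_modl -(modnDm _ _ M) -modnMml sM modnMml mul0n tM modnDm.
    rewrite add0n !coprime_modl coprime1n andbT.
    by rewrite coprime_sym prime_coprime // gtnNdvd // ltnS ltn_ord.
  by under eq_bigr do rewrite expr0 mul1r.
move=> x y xp yp; apply: (@mulfI _ p%:R); first by rewrite pnatr_eq0 -lt0n.
by rewrite !key.
Qed.

(** * Five roots of unity of sum 0 without opposite pairs *)

Section FiveRootsOfUnity.

Variables (z : 'I_5 -> algC).
Hypotheses (z_neq0 : forall i, z i != 0) (sum_z : \sum_i z i = 0)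
  (z_opp : forall i j, z i + z j != 0).

(** Either [B] or its complement has at most two elements, both have sum 0, and a vanishing sum of
    at most two terms is empty. *)
Lemma no_vanishing_subsum (B : {set 'I_5}) i :
  \sum_(j in B) z j = 0 -> i \in B -> forall j, j \in B.
Proof.
have small (C : {set 'I_5}) : (#|C| <= 2)%N -> \sum_(j in C) z j = 0 -> C = set0.
  rewrite leq_eqVlt ltnS => /orP[/cards2P[x [y [xy ->]]]|].
    by rewrite big_setU1 ?inE //= big_set1 => /eqP; rewrite (negPf (z_opp _ _)).
  rewrite leq_eqVlt ltnS leqn0 cards_eq0 => /orP[/cards1P[x ->]|/eqP //].
  by rewrite big_set1 => /eqP; rewrite (negPf (z_neq0 _)).
move=> sB iB; case: (leqP #|B| 2) => cB.
  by move: iB; rewrite (small B cB sB) inE.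
have sC : \sum_(j in ~: B) z j = 0.
  rewrite -[RHS]sum_z [RHS](bigID (mem B)) /= sB add0r.
  by apply: eq_bigl => j; rewrite inE.
have cC : (#|~: B| <= 2)%N by rewrite cardsCs setCK card_ord leq_subLR; lia.
by move=> j; have := small _ cC sC => /setP/(_ j); rewrite !inE => /negbFE.
Qed.

(** Write each root as a cube root of unity times a sign. Without opposite pairs the sign is
    constant on each of the three classes, so the equal class sums are the class sizes up to sign.
    Squaring removes the sign: the sizes agree, but 3 does not divide 5. *)
Lemma five_unity_order6 : ~ (forall i, z i ^+ 6 = 1).
Proof.
move=> z6.
have [a [w [zE a3 w2 eqS]]] :=
  @sum_fiber_coprime _ z 3 2 isT isT isT z6 sum_z.
have cnt x : x ^+ 3 = 1 ->
    (\sum_(i | a i == x) w i) ^+ 2 = (#|[pred i | a i == x]| ^ 2)%N%:R.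
  move=> x3; case: (pickP [pred i | a i == x]) => [i0 /= /eqP ai0|no]; last first.
    by rewrite big_pred0 // (eq_card0 no) expr0n.
  have wE i : a i == x -> w i = w i0.
    move=> /eqP ai; have /eqP := w2 i; rewrite -(w2 i0) -subr_eq0 subr_sqr.
    rewrite mulf_eq0 subr_eq0 => /orP[/eqP //|/eqP ww].
    have := z_opp i i0; rewrite !zE ai ai0 -mulrDr ww mulr0 eqxx //.
  rewrite (eq_bigr (fun=> w i0)) //.
  rewrite sumr_const exprMn_n w2 //.
have [om pom] := @C_prim_root_exists 3 isT.
have om3 := prim_expr_order pom.
pose m := #|[pred i | a i == 1]|.
have cm x : x ^+ 3 = 1 -> #|[pred i | a i == x]| = m.
  move=> x3; apply/eqP; rewrite -(eqn_exp2r _ _ (isT : 0 < 2)%N) -(eqr_nat algC).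
  by rewrite -!cnt ?expr1n // (eqS x 1) // expr1n.
have : (\sum_(j < 3) #|[pred i | a i == om ^+ j]| = 5)%N.
  rewrite -[RHS](card_ord 5) -[RHS]sum1_card.
  transitivity (\sum_(j < 3) \sum_(i | a i == om ^+ j) 1)%N.
    by apply: eq_bigr => j _; rewrite sum1_card.
  rewrite (exchange_big_dep predT) //=.
  apply: eq_bigr => i _.
  have [k ->] := prim_rootP pom (a3 i).
  rewrite (eq_bigl (pred1 k)) ?big_pred1_eq // => j /=.
  by rewrite (eq_prim_root_expr pom) !modn_small // eq_sym.
rewrite (eq_bigr (fun=> m)) => [|j _]; last first.
  by apply: cm; rewrite -exprM mulnC exprM om3 expr1n.
by rewrite sum_nat_const card_ord; lia.
Qed.

(** Strong induction on the common exponent [N]. The normalisation [z ord0 = 1] makes the class of 1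
    nonempty. *)
Lemma five_roots_of_unity N : (0 < N)%N ->
  z ord0 = 1 -> (forall i, z i ^+ N = 1) ->
  injective z /\ forall i, z i ^+ 5 = 1.
Proof.
move=> N0 z0; elim/ltn_ind: N N0 => N IH N0 zN.
(* If p ^ 2 divides N, the class of 1 modulo the subgroup of order N / p sums to
   0, hence is everything and N can be replaced with N / p. *)
case: (boolP (has (fun p => p * p %| N)%N (primes N))) => [|/hasPn nosq].
  case/hasP => p; rewrite mem_primes => /and3P[pp _ _] /dvdnP[q Nq].
  pose M := (q * p)%N.
  have NE : N = (p * M)%N by rewrite Nq /M; ring.
  have M0 : (0 < M)%N by move: N0; rewrite NE muln_gt0 => /andP[].
  apply: (IH M) => // [|i].
    by rewrite NE ltn_Pmull // prime_gt1.
  have zpM j : z j ^+ (p * M) = 1 by rewrite -NE.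
  have s0 := sum_fiber_square (prime_gt0 pp) M0 (dvdn_mull q (dvdnn p)) zpM
    sum_z (expr1n _ p).
  have := @no_vanishing_subsum [set i | z i ^+ M == 1] ord0.
  rewrite (eq_bigl (fun i => z i ^+ M == 1)); last by move=> j; rewrite inE.
  by move=> /(_ s0); rewrite inE z0 expr1n eqxx => /(_ isT i); rewrite inE => /eqP.
(* If p >= 5 divides N exactly once, the p classes have equal sums: either one of
   them is empty and N can be replaced with N / p, or p = 5 and all of them are
   singletons. *)
case: (boolP (has (fun p => 5 <= p)%N (primes N))) => [|/hasPn no5].
  case/hasP => p pN p5; have := pN; rewrite mem_primes => /and3P[pp _ /dvdnP[M NM]].
  have NE : N = (p * M)%N by rewrite NM mulnC.
  have p0 := prime_gt0 pp.
  have M0 : (0 < M)%N by move: N0; rewrite NE muln_gt0 => /andP[].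
  have pM : coprime p M.
    rewrite prime_coprime //; apply: contra (nosq _ pN) => pM.
    by rewrite NE dvdn_pmul2l.
  have zpM j : z j ^+ (p * M) = 1 by rewrite -NE.
  have [a [w [zE ap wM eqS]]] := sum_fiber_coprime pp M0 pM zpM sum_z.
  have [om pom] := C_prim_root_exists p0.
  have omp := prim_expr_order pom.
  case: (boolP [forall k : 'I_p, om ^+ k \in codom a]) => [/forallP surj|]; last first.
    rewrite negb_forall => /existsP[k /negP nk].
    have s0 : \sum_(i | a i == a ord0) w i = 0.
      rewrite (eqS _ (om ^+ k)) ?ap //; last by rewrite -exprM mulnC exprM omp expr1n.
      by apply: big_pred0 => i; apply/negP => /eqP ak; apply: nk; rewrite -ak codom_f.
    have aE i : a i = a ord0.
      have := @no_vanishing_subsum [set i | a i == a ord0] ord0.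
      rewrite (eq_bigl (fun i => a i == a ord0)); last by move=> j; rewrite inE.
      rewrite (eq_bigr (fun j => a ord0 * w j)); last by move=> j /eqP aj; rewrite zE aj.
      by rewrite -mulr_sumr s0 mulr0 inE eqxx => /(_ erefl isT i); rewrite inE => /eqP.
    apply: (IH M) => // [|i].
      by rewrite NE ltn_Pmull // prime_gt1.
    have a0 : a ord0 ^+ M = 1.
      by rewrite -[LHS]mulr1 -(wM ord0) -exprMn -zE z0 expr1n.
    by rewrite zE aE exprMn wM mulr1.
  pose rs := [seq om ^+ (k : 'I_p) | k <- enum 'I_p].
  have urs : uniq rs.
    rewrite map_inj_uniq ?enum_uniq // => k l /eqP.
    by rewrite (eq_prim_root_expr pom) !modn_small // => /eqP /val_inj.
  have srs : size rs = p by rewrite size_map size_enum_ord.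
  have sub : {subset rs <= codom a} by move=> _ /mapP[k _ ->].
  have := uniq_leq_size urs sub; rewrite srs size_codom card_ord => p5'.
  have {p5 p5'} p5 : p = 5%N by apply/eqP; rewrite eqn_leq p5' p5.
  have ainj : injective a.
    apply/injectiveP; apply: (leq_size_uniq urs sub).
    by rewrite srs size_codom card_ord p5.
  (* Since [a] is injective, every class sum is a single value of [w]. *)
  have wE i j : w i = w j.
    have := eqS (a i) (a j) (ap i) (ap j).
    rewrite (big_pred1 i) ?(big_pred1 j) // => k; exact: inj_eq.
  have z5 i : z i ^+ 5 = 1.
    by rewrite zE (wE i ord0) exprMn -p5 ap -(ap ord0) -exprMn -zE z0 expr1n.
  split=> // i j; rewrite !zE (wE i j) => /mulIf aij; apply/ainj/aij.
  by have := z_neq0 j; rewrite zE mulf_eq0 negb_or => /andP[].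
(* What is left is a squarefree [N] whose prime factors are below 5, hence a divisor of 6. *)
case: five_unity_order6 => i.
suff /dvdnP[q ->] : (N %| 6)%N by rewrite mulnC exprM zN expr1n.
have lem p : p \in primes N -> (p < 5)%N by move=> /no5; rewrite -ltnNge.
apply/dvdn_partP => // p pN; have {}pN : p \in primes N by [].
have log1 : logn p N = 1%N.
  have := pN; rewrite mem_primes => /and3P[pp _ pdN].
  apply/eqP; rewrite eqn_leq -(pfactor_dvdn 1 pp N0) expn1 pdN andbT.
  by rewrite leqNgt -(pfactor_dvdn 2 pp N0) (negPf (nosq _ pN)).
rewrite p_part log1 expn1.
have := lem _ pN; move: pN; rewrite mem_primes => /andP[pp _].
by case: p pp {log1} => [|[|[|[|[|p]]]]].
Qed.

End FiveRootsOfUnity.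

(** * Complex Hadamard matrices of order 5 *)

Lemma uniq_extend n (s : seq 'I_n) : uniq s ->
  exists r, uniq (s ++ r) /\ (size s + size r = n)%N.
Proof.
move=> us; exists [seq x <- enum 'I_n | x \notin s].
rewrite cat_uniq us filter_uniq ?enum_uniq // andbT.
split; first by apply/hasPn => x; rewrite mem_filter => /andP[].
rewrite size_filter -[RHS](size_enum_ord n) -(count_predC (mem s) (enum 'I_n)).
congr addn; rewrite -size_filter; apply/perm_size/uniq_perm => //.
  by rewrite filter_uniq ?enum_uniq.
by move=> x; rewrite mem_filter mem_enum andbT.
Qed.

Lemma uniq_extend3 (a b c : 'I_5) : uniq [:: a; b; c] ->
  exists d e, uniq [:: a; b; c; d; e].
Proof.
move=> /uniq_extend[r []]; case: r => [|d [|e [|? ?]]] // U _; by exists d, e.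
Qed.

Lemma uniq_extend2 (a b : 'I_5) : a != b ->
  exists c d e, uniq [:: a; b; c; d; e].
Proof.
move=> ab; have : uniq [:: a; b] by rewrite /= inE ab.
move=> /uniq_extend[r []]; case: r => [|c [|d [|e [|? ?]]]] // U _.
by exists c, d, e.
Qed.

Lemma perm_enum_uniq n (s : seq 'I_n) :
  uniq s -> size s = n -> perm_eq s (index_enum 'I_n).
Proof.
move=> us ss; apply: uniq_perm; rewrite ?index_enum_uniq // => x.
rewrite mem_index_enum; have := @uniq_min_size _ s (enum 'I_n) us.
rewrite size_enum_ord ss => -[|//|_ ->]; last by rewrite mem_enum.
by move=> y; rewrite mem_enum.
Qed.

Lemma sum_uniq5 (R : nmodType) (a b c d e : 'I_5) (F : 'I_5 -> R) :
  uniq [:: a; b; c; d; e] -> \sum_i F i = F a + (F b + (F c + (F d + F e))).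
Proof.
move=> u5; rewrite -(perm_big _ (perm_enum_uniq u5 erefl)).
by rewrite !big_cons big_nil /= addr0.
Qed.

Lemma unimodular_neq0 (x : algC) : `|x| = 1 -> x != 0.
Proof. by move=> x1; rewrite -normr_eq0 x1 oner_eq0. Qed.

Lemma invC_unimodular (x : algC) : `|x| = 1 -> x^-1 = x^*.
Proof. by move=> x1; rewrite invC_norm x1 expr1n invr1 mul1r. Qed.

Lemma sum_inv_normC (I : finType) (u : I -> algC) :
  (forall i, `|u i| = 1) -> \sum_i u i = 0 -> \sum_i (u i)^-1 = 0.
Proof.
move=> u1 s0; under eq_bigr do rewrite invC_unimodular //.
by rewrite -rmorph_sum s0 rmorph0.
Qed.

(** The first two elementary symmetric functions vanish, so the three numbers are roots of T^3 =
    xyz. For unimodular numbers the sum of inverses is the conjugate sum. *)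
Lemma sum3_inv_sum3 (F : fieldType) (x y z : F) :
  x != 0 -> y != 0 -> z != 0 ->
  x + y + z = 0 -> x^-1 + y^-1 + z^-1 = 0 ->
  exists w, [/\ w ^+ 2 + w + 1 = 0, y = w * x & z = w ^+ 2 * x].
Proof.
move=> x0 y0 z0 s0 sV.
have e2 : x * y + y * z + z * x = 0.
  by rewrite -[RHS](mulr0 (x * y * z)) -sV; field; rewrite x0 y0 z0.
have zE : z = - (x + y) by rewrite -[LHS]addr0 -[in RHS](addrK z (x + y)) s0; ring.
have q : x ^+ 2 + x * y + y ^+ 2 = 0.
  by rewrite -[RHS]oppr0 -e2 zE; ring.
exists (y / x); split; first last.
- rewrite zE -[LHS]addr0 -[X in _ + X](mul0r x^-1) -q; field => //.
- by rewrite mulfVK.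
by rewrite -[RHS](mul0r (x ^- 2)) -q; field.
Qed.

Lemma primitive_cube_rootsP (F : fieldType) (w v : F) :
  w ^+ 2 + w + 1 = 0 -> v ^+ 2 + v + 1 = 0 -> w = v \/ w * v = 1.
Proof.
move=> ew ev.
have : (w - v) * (w + v + 1) = 0.
  by rewrite -[RHS](subrr 0) -{1}ew -ev; ring.
move/eqP; rewrite mulf_eq0 subr_eq0 => /orP[/eqP ->|/eqP h]; [by left|right].
have -> : w = - (v + 1) by rewrite -[LHS]addr0 -[X in _ + X]oppr0 -h; ring.
by rewrite -[RHS](subr0 1) -ev; ring.
Qed.

(** The opposite pair cancels both in the sum and in the sum of inverses, which leaves the
    hypotheses of [sum3_inv_sum3]. *)
Lemma opposite_pair_rest (x : 'I_5 -> algC) a b c d e :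
  (forall i, `|x i| = 1) -> \sum_i x i = 0 ->
  uniq [:: a; b; c; d; e] -> x a + x b = 0 ->
  exists w, [/\ w ^+ 2 + w + 1 = 0, x d = w * x c & x e = w ^+ 2 * x c].
Proof.
move=> x1 sx U xab; have x0 i := unimodular_neq0 (x1 i).
apply: sum3_inv_sum3 => //.
  by move: sx; rewrite (sum_uniq5 _ U) !addrA xab add0r.
have := sum_inv_normC x1 sx; rewrite (sum_uniq5 _ U) !addrA.
have -> : x b = - x a by rewrite -[LHS]addr0 -(subrr (x a)) addrA [x b + _]addrC xab sub0r.
by rewrite invrN subrr add0r.
Qed.

(** * Opposite pairs of two orthogonal unimodular vectors of length 5 *)

Section UnimodularVectors.

Variables u v : 'I_5 -> algC.
Hypotheses (u1 : forall a, `|u a| = 1) (v1 : forall a, `|v a| = 1).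
Hypotheses (su : \sum_a u a = 0) (sv : \sum_a v a = 0)
  (suv : \sum_a u a / v a = 0).

(** A shared pair contributes a number of modulus 2 to the inner product, while the two triples of
    cube roots contribute one of modulus 3 or 0, so the total cannot vanish. *)
Lemma opposite_pair_neq a b : a != b -> u a + u b = 0 -> v a + v b = 0 -> False.
Proof.
move=> ab uab vab.
have [c [d [e U]]] := uniq_extend2 ab.
have [w [ew ud ue]] := opposite_pair_rest u1 su U uab.
have [w' [ew' vd ve]] := opposite_pair_rest v1 sv U vab.
have v0 i := unimodular_neq0 (v1 i).
have ub : u b = - u a by apply/eqP; rewrite -addr_eq0 addrC uab.
have vb : v b = - v a by apply/eqP; rewrite -addr_eq0 addrC vab.
have w'0 : w' != 0.
  by apply/eqP => w0; have := v0 d; rewrite vd w0 mul0r eqxx.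
have := suv; rewrite (sum_uniq5 _ U) ub vb ud ue vd ve.
have -> : u a / v a + (- u a / - v a + (u c / v c + (w * u c / (w' * v c) +
    w ^+ 2 * u c / (w' ^+ 2 * v c)))) =
    2 * (u a / v a) + (1 + w / w' + (w / w') ^+ 2) * (u c / v c).
  by field; rewrite !v0 w'0.
have n1 i : `|u i / v i| = 1 by rewrite normrM normfV u1 v1 invr1 mulr1.
case: (primitive_cube_rootsP ew ew') => [wE|ww'].
  rewrite wE divff // expr1n => /eqP; rewrite addr_eq0 => /eqP /(congr1 Num.norm).
  have -> : 1 + 1 + 1 = 3 :> algC by ring.
  rewrite normrN [`|2 * _|]normrM [`|3 * _|]normrM !n1 !mulr1.
  by rewrite !normr_nat => /eqP; rewrite eqr_nat.
have -> : w / w' = w ^+ 2.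
  by apply: (mulIf w'0); rewrite mulfVK // expr2 -mulrA ww' mulr1.
have -> : 1 + w ^+ 2 + (w ^+ 2) ^+ 2 = (w ^+ 2 + w + 1) * (w ^+ 2 - w + 1) by ring.
rewrite ew !mul0r addr0 => /(congr1 Num.norm)/eqP.
by rewrite [`|2 * _|]normrM n1 mulr1 normr_nat normr0 pnatr_eq0.
Qed.

(** The triples left over are {b, d, e} for [u] and {a, d, e} for [v], so orthogonality and its
    conjugate become two equations in the values of [u] at a, b and of [v] at a, s. The second
    conclusion says that the quotient of [u] by [v] is opposite at a and b. *)
Lemma adjacent_opposite_pairs a s b : uniq [:: a; s; b] ->
  u a + u s = 0 -> v s + v b = 0 ->
  u a ^+ 2 = - u b ^+ 2 /\ u a * v b + u b * v a = 0.
Proof.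
move=> Ua uas vsb.
have [d [e U]] := uniq_extend3 Ua.
have U' : uniq [:: s; b; a; d; e].
  rewrite (@perm_uniq _ _ [:: a; s; b; d; e]) //.
  by apply/permP => P /=; lia.
have [w [ew ud ue]] := opposite_pair_rest u1 su U uas.
have [w' [ew' vd ve]] := opposite_pair_rest v1 sv U' vsb.
have u0 i := unimodular_neq0 (u1 i).
have v0 i := unimodular_neq0 (v1 i).
have us : u s = - u a by apply/eqP; rewrite -addr_eq0 addrC uas.
have vb : v b = - v s by apply/eqP; rewrite -addr_eq0 addrC vsb.
(* Here [c] is r + r^2 with r = w / w': it is 2 if w = w' and -1 if w and w' are inverse. *)
have [c [hc e1 e2]] : exists c : algC, [/\ c = 2 \/ c = -1,
    u d / v d + u e / v e = c * (u b / v a) &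
    v d / u d + v e / u e = c * (v a / u b)].
  have w3 : w ^+ 3 = 1.
    apply/eqP; rewrite -subr_eq0; apply/eqP.
    by rewrite -[RHS](mulr0 (w - 1)) -ew; ring.
  have w0 := neq0_of_expr1 (isT : 0 < 3)%N w3.
  rewrite ud ue vd ve; case: (primitive_cube_rootsP ew ew') => [<-|ww'].
    by exists 2; split; [by left|field|field]; rewrite ?u0 ?v0 w0.
  have -> : w' = w ^+ 2 by apply: (mulfI w0); rewrite ww' -exprS w3.
  exists (-1); split; first (by right); apply/eqP; rewrite -subr_eq0; apply/eqP.
    rewrite -[RHS](mul0r (u b / v a / w ^+ 2)) -ew; field.
    by rewrite v0 w0.
  rewrite -[RHS](mul0r (v a / u b)) -ew; field.
  by rewrite u0 w0.
have sVu : \sum_i v i / u i = 0.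
  rewrite -[RHS](@sum_inv_normC _ (fun i => u i / v i)) //.
    by apply: eq_bigr => i _; rewrite invfM invrK mulrC.
  by move=> i; rewrite normrM normfV u1 v1 invr1 mulr1.
set X := u a in us *; set B := u b in e1 e2 *.
set p := v a in e1 e2 *; set q := v s in vb *.
have [X0 B0 p0 q0] : [/\ X != 0, B != 0, p != 0 & q != 0] by rewrite /X /B /p /q.
(* [E1] and [E2] are the orthogonality relation and its conjugate, cleared of denominators; their
   sum is [(c - 1) * (B * q + X * p)]. *)
have E1 : X * q - X * p - B * p + c * B * q = 0.
  rewrite -[RHS](mul0r (p * q)) -suv (sum_uniq5 _ U) e1 us vb -/X -/B -/p -/q.
  by field; rewrite p0 q0.
have E2 : p * B - q * B - q * X + c * p * X = 0.
  rewrite -[RHS](mul0r (B * X)) -sVu (sum_uniq5 _ U) e2 us vb -/X -/B -/p -/q.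
  by field; rewrite X0 B0.
have XpBq : X * p = - (B * q).
  have : (c - 1) * (B * q + X * p) = 0 by rewrite -[RHS]addr0 -{1}E1 -E2; ring.
  move/eqP; rewrite mulf_eq0 subr_eq0 => /orP[|/eqP h]; last first.
    by apply/eqP; rewrite -addr_eq0 addrC h.
  case: hc => ->; first by rewrite (eqr_nat _ 2 1).
  by rewrite eq_sym -addr_eq0 (eqr_nat _ 2 0).
case: hc => cE; last first.
  have XqBp : X * q = B * p.
    apply/eqP; rewrite -subr_eq0; apply/eqP; rewrite -[RHS]E1 XpBq cE; ring.
  split; last by rewrite vb -/q -XqBp; ring.
  apply/eqP; rewrite -addr_eq0; apply/eqP/(mulfI q0); rewrite mulr0.
  have -> : q * (X ^+ 2 + B ^+ 2) = X * (X * q - B * p) + B * (X * p + B * q).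
    by ring.
  by rewrite XqBp XpBq; ring.
(* For [c = 2] the equations force X^2 + B^2 = -3BX, where the left side has modulus at most 2 and
   the right side modulus 3. *)
exfalso.
have h : X ^+ 2 + B ^+ 2 = - 3 * (B * X).
  apply: (mulIf q0); apply/eqP; rewrite -subr_eq0; apply/eqP.
  have -> : (X ^+ 2 + B ^+ 2) * q - - 3 * (B * X) * q =
     X * (X * q - X * p - B * p + 2 * B * q) + (X + B) * (X * p + B * q) by ring.
  by rewrite -cE E1 XpBq; ring.
have : `|X ^+ 2 + B ^+ 2| <= 2.
  by apply: le_trans (ler_normD _ _) _; rewrite !normrX !u1 !expr1n.
by rewrite h !normrM normrN !u1 !mulr1 normr_nat ler_nat.
Qed.

End UnimodularVectors.

(** * Opposite pairs among the rows of a Hadamard matrix of order 5 *)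

Section HadamardFive.

Variable H : 'I_5 -> 'I_5 -> algC.
Hypotheses (H1 : forall i a, `|H i a| = 1)
  (orthH : forall i j, i != j -> \sum_a H i a / H j a = 0).

(* The quotient of rows i and j takes opposite values at a and b. *)
Definition opposite i j a b := H i a * H j b + H i b * H j a = 0.

Lemma oppositeC i j a b : opposite i j a b -> opposite j i a b.
Proof. by rewrite /opposite => <-; ring. Qed.

Lemma opposite_swap i j a b : opposite i j a b -> opposite i j b a.
Proof. by rewrite /opposite => <-; ring. Qed.

Lemma H_neq0 i a : H i a != 0. Proof. exact: unimodular_neq0. Qed.

Lemma norm_quotient i j a : `|H j a / H i a| = 1.
Proof. by rewrite normrM normfV !H1 invr1 mulr1. Qed.

Lemma opposite_quotient i j a b :
  opposite i j a b <-> H j a / H i a + H j b / H i b = 0.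
Proof.
have -> : H j a / H i a + H j b / H i b =
    (H i a * H j b + H i b * H j a) / (H i a * H i b).
  by field; rewrite !H_neq0.
split=> [->|/eqP]; first by rewrite mul0r.
by rewrite mulf_eq0 invr_eq0 mulf_eq0 !(negPf (H_neq0 _ _)) /= orbF => /eqP.
Qed.

Lemma sum_quotients i j k : j != k ->
  \sum_a (H j a / H i a) / (H k a / H i a) = 0.
Proof.
move=> jk; rewrite -[RHS](orthH jk); apply: eq_bigr => a _.
by field; rewrite !H_neq0.
Qed.

Lemma sum_quotient i j : i != j -> \sum_a H j a / H i a = 0.
Proof. by rewrite eq_sym; apply: orthH. Qed.

Lemma opposite_rows_neq i j k a b : uniq [:: i; j; k] -> a != b ->
  opposite i j a b -> opposite i k a b -> False.
Proof.
rewrite /= !inE negb_or andbT => /andP[/andP[ij ik] jk] ab.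
move=> /opposite_quotient oj /opposite_quotient ok.
exact: (opposite_pair_neq (norm_quotient i j) (norm_quotient i k)
  (sum_quotient ij) (sum_quotient ik) (sum_quotients i jk) ab oj ok).
Qed.

(** The second conclusion concerns the rows j and k, so adjacency can be applied again with another
    base row. *)
Lemma opposite_adjacent i j k a s b : uniq [:: i; j; k] -> uniq [:: a; s; b] ->
  opposite i j a s -> opposite i k s b ->
  (H j a / H i a) ^+ 2 = - (H j b / H i b) ^+ 2 /\ opposite j k a b.
Proof.
move=> Ur asb; move: Ur.
rewrite /= !inE negb_or andbT => /andP[/andP[ij ik] jk].
move=> /opposite_quotient oj /opposite_quotient ok.
have [sq e] := adjacent_opposite_pairs (norm_quotient i j) (norm_quotient i k)
  (sum_quotient ij) (sum_quotient ik) (sum_quotients i jk) asb oj ok.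
split=> //; rewrite /opposite -[RHS](mulr0 (H i a * H i b)) -e; field.
by rewrite !H_neq0.
Qed.

Lemma opposite_rest i j a b c d : i != j -> uniq [:: a; b; c; d] ->
  opposite i j a b ->
  (H j c / H i c) ^+ 2 + (H j c / H i c) * (H j d / H i d) +
    (H j d / H i d) ^+ 2 = 0.
Proof.
move=> ij /uniq_extend[r []]; case: r => [|e [|? ?]] // U _ /opposite_quotient o.
have U' : uniq [:: a; b; c; d; e] by [].
have [w [ew -> _]] :=
  opposite_pair_rest (norm_quotient i j) (sum_quotient ij) U' o.
by rewrite -[RHS](mul0r ((H j c / H i c) ^+ 2)) -ew; ring.
Qed.

(* [opposite i k b q] follows by adjacency, so the quotient of rows k and i has
   opposite squares at a and b, whereas a, b lie in a triple proportional to the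
   cube roots of unity. *)
Lemma opposite_no_bridge i j k a b c d q :
  uniq [:: i; j; k] -> uniq [:: a; b; c; d] -> uniq [:: a; b; q] ->
  opposite i j a b -> opposite i k c d -> opposite j k a q -> False.
Proof.
move=> Ur Uc Uq oab ocd oaq.
have Ur' : uniq [:: j; i; k].
  by rewrite (@perm_uniq _ _ [:: i; j; k]) //; apply/permP => P /=; ring.
have Ur'' : uniq [:: i; k; j].
  by rewrite (@perm_uniq _ _ [:: i; j; k]) //; apply/permP => P /=; ring.
have Ub : uniq [:: b; a; q].
  by rewrite (@perm_uniq _ _ [:: a; b; q]) //; apply/permP => P /=; ring.
have Ub' : uniq [:: q; b; a].
  by rewrite (@perm_uniq _ _ [:: a; b; q]) //; apply/permP => P /=; ring.
have Uc' : uniq [:: c; d; a; b].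
  by rewrite (@perm_uniq _ _ [:: a; b; c; d]) //; apply/permP => P /=; ring.
have ik : i != k by move: Ur; rewrite /= !inE negb_or => /andP[/andP[]].
have [_ obq] := opposite_adjacent Ur' Ub (opposite_swap (oppositeC oab)) oaq.
have [sq _] := opposite_adjacent Ur'' Ub' (opposite_swap obq) (opposite_swap oab).
have bb : (H k b / H i b) ^+ 2 = - (H k a / H i a) ^+ 2.
  have /opposite_quotient/eqP := obq; rewrite addr_eq0 => /eqP ->.
  by rewrite sqrrN sq.
have := opposite_rest ik Uc' ocd; rewrite bb addrAC subrr add0r => /eqP.
by rewrite !mulf_eq0 !invr_eq0 !(negPf (H_neq0 _ _)).
Qed.

(** If q also lies in {a, b}, two quotients by row j share a pair; otherwise, up to exchanging a and
    b, this is [opposite_no_bridge]. *)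
Lemma opposite_no_bridge2 i j k a b c d p q :
  uniq [:: i; j; k] -> uniq [:: a; b; c; d] -> p \in [:: a; b] -> p != q ->
  opposite i j a b -> opposite i k c d -> opposite j k p q -> False.
Proof.
move=> Ur Uc pab pq oab ocd opq.
have Ur' : uniq [:: j; i; k].
  by rewrite (@perm_uniq _ _ [:: i; j; k]) //; apply/permP => P /=; ring.
have ab : a != b by move: Uc; rewrite /= !inE !negb_or => /andP[/andP[]].
have Uc' : uniq [:: b; a; c; d].
  by rewrite (@perm_uniq _ _ [:: a; b; c; d]) //; apply/permP => P /=; ring.
case: (boolP (q \in [:: a; b])) => [qab|qab].
  apply: (opposite_rows_neq Ur' ab (oppositeC oab)).
  move: pab qab pq; rewrite !inE => /orP[]/eqP pE /orP[]/eqP qE; move: opq;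
    rewrite pE qE ?eqxx // => o _; exact: opposite_swap.
move: qab pab opq; rewrite !inE negb_or => /andP[qa qb] /orP[]/eqP -> opq.
  apply: (opposite_no_bridge Ur Uc _ oab ocd opq).
  by rewrite /= !inE !(eq_sym _ q) negb_or ab qa qb.
apply: (opposite_no_bridge Ur Uc' _ (opposite_swap oab) ocd opq).
by rewrite /= !inE !(eq_sym _ q) negb_or (eq_sym b) ab qa qb.
Qed.

Hypothesis ex_opposite :
  forall i j, i != j -> exists a b, a != b /\ opposite i j a b.

(** Two disjoint pairs leave only one of the five columns, so an opposite pair of rows j and k must
    meet one of them, which [opposite_no_bridge2] forbids. *)
Lemma opposite_meet i j k a b c d :
  uniq [:: i; j; k] -> uniq [:: a; b; c; d] ->
  opposite i j a b -> opposite i k c d -> False.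
Proof.
move=> Ur Uc oab ocd.
have jk : j != k by move: Ur; rewrite /= !inE negb_or => /andP[_ /andP[]].
have [p [q [pq opq]]] := ex_opposite jk.
have Ur' : uniq [:: i; k; j].
  by rewrite (@perm_uniq _ _ [:: i; j; k]) //; apply/permP => P /=; ring.
have Uc' : uniq [:: c; d; a; b].
  by rewrite (@perm_uniq _ _ [:: a; b; c; d]) //; apply/permP => P /=; ring.
have qp : q != p by rewrite eq_sym.
case: (boolP (p \in [:: a; b])) => [pab|pab].
  exact: opposite_no_bridge2 Ur Uc pab pq oab ocd opq.
case: (boolP (q \in [:: a; b])) => [qab|qab].
  exact: opposite_no_bridge2 Ur Uc qab qp oab ocd (opposite_swap opq).
case: (boolP (p \in [:: c; d])) => [pcd|pcd].
  exact: opposite_no_bridge2 Ur' Uc' pcd pq ocd oab (oppositeC opq).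
case: (boolP (q \in [:: c; d])) => [qcd|qcd].
  exact: opposite_no_bridge2 Ur' Uc' qcd qp ocd oab (opposite_swap (oppositeC opq)).
have /card_uniqP : uniq [:: p; q; a; b; c; d].
  rewrite /= !inE !negb_or in Uc pab qab pcd qcd *.
  rewrite pq Uc andbT.
  by case/andP: pab => -> ->; case/andP: qab => -> ->; case/andP: pcd => -> ->.
by move=> E; have := max_card (mem [:: p; q; a; b; c; d]); rewrite E card_ord.
Qed.

(** The pair of rows i and k meets {a, b} without being equal to it. The relation for q is the same
    whichever endpoint is shared, since opposite numbers have equal squares. *)
Lemma opposite_next i j k a b : uniq [:: i; j; k] -> a != b ->
  opposite i j a b ->
  exists s q, [/\ s \in [:: a; b], q \notin [:: a; b], opposite i k s q
    & (H j a / H i a) ^+ 2 = - (H j q / H i q) ^+ 2].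
Proof.
move=> Ur ab oab.
have ik : i != k by move: Ur; rewrite /= !inE negb_or => /andP[/andP[]].
suff [s [q [sab qab osq]]] : exists s q,
    [/\ s \in [:: a; b], q \notin [:: a; b] & opposite i k s q].
  exists s, q; split=> //.
  move: (qab) (sab) osq; rewrite !inE negb_or => /andP[qa qb] /orP[]/eqP -> osq.
    have U : uniq [:: b; a; q] by rewrite /= !inE !(eq_sym _ q) negb_or (eq_sym b) ab qb qa.
    have [<- _] := opposite_adjacent Ur U (opposite_swap oab) osq.
    have /opposite_quotient/eqP := oab; rewrite addr_eq0 => /eqP ->.
    by rewrite sqrrN.
  have U : uniq [:: a; b; q] by rewrite /= !inE !(eq_sym _ q) negb_or ab qb qa.
  by have [<- _] := opposite_adjacent Ur U oab osq.
have [c [d [cd ocd]]] := ex_opposite ik.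
case: (boolP (c \in [:: a; b])) => cab; case: (boolP (d \in [:: a; b])) => dab.
- case: (opposite_rows_neq Ur ab oab).
  move: cab dab cd; rewrite !inE => /orP[]/eqP cE /orP[]/eqP dE; move: ocd;
    rewrite cE dE ?eqxx // => o _; exact: opposite_swap.
- by exists c, d.
- by exists d, c; split=> //; apply: opposite_swap.
case: (opposite_meet Ur _ oab ocd).
move: cab dab; rewrite /= !inE !negb_or => /andP[ca cb] /andP[da db].
by rewrite ab cd !(eq_sym _ c) !(eq_sym _ d) ca cb da db.
Qed.

Lemma not_all_opposite : False.
Proof.
pose r k (lt : (k < 5)%N) := Ordinal lt.
pose r0 := r 0 isT; pose r1 := r 1%N isT; pose r2 := r 2 isT.
pose r3 := r 3 isT; pose r4 := r 4 isT.
have [a [b [ab oab]]] := @ex_opposite r0 r1 isT.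
have [s2 [q2 [s2ab q2ab o2 e2]]] := @opposite_next r0 r1 r2 a b isT ab oab.
have [s3 [q3 [s3ab q3ab o3 e3]]] := @opposite_next r0 r1 r3 a b isT ab oab.
have [s4 [q4 [s4ab q4ab o4 e4]]] := @opposite_next r0 r1 r4 a b isT ab oab.
(* For distinct q and q' the quotient takes values x, y there with x^2 + xy + y^2 = 0. Equal squares
   would give 2x^2 = -xy, of moduli 2 and 1. *)
have qE q q' : q \notin [:: a; b] -> q' \notin [:: a; b] ->
    (H r1 a / H r0 a) ^+ 2 = - (H r1 q / H r0 q) ^+ 2 ->
    (H r1 a / H r0 a) ^+ 2 = - (H r1 q' / H r0 q') ^+ 2 -> q = q'.
  move=> qab q'ab -> /oppr_inj e; apply/eqP/negP => /negP qq'.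
  have U : uniq [:: a; b; q; q'].
    move: qab q'ab; rewrite /= !inE !negb_or => /andP[qa qb] /andP[q'a q'b].
    by rewrite ab qq' !(eq_sym _ q) !(eq_sym _ q') qa qb q'a q'b.
  have := @opposite_rest r0 r1 a b q q' isT U oab.
  rewrite -e addrAC -mulr2n => /eqP; rewrite addr_eq0 => /eqP/(congr1 Num.norm)/eqP.
  rewrite normrN -mulr_natl normrM normr_nat normrX [`|_ / _ * _|]normrM.
  by rewrite !norm_quotient expr1n !mulr1 (eqr_nat _ 2 1).
have q23 := qE _ _ q2ab q3ab e2 e3; have q24 := qE _ _ q2ab q4ab e2 e4.
have sq2 : s2 != q2 by apply: contraNneq q2ab => <-.
have sq3 : s3 != q2 by rewrite q23; apply: contraNneq q3ab => <-.
rewrite -q23 in o3; rewrite -q24 in o4.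
(* The second column is now common, and two of [s2], [s3], [s4] coincide because all lie in {a,
   b}. *)
case: (eqVneq s2 s3) => [s23|s23].
  by rewrite -s23 in o3; apply: (@opposite_rows_neq r0 r2 r3 _ _ isT sq2 o2 o3).
case: (eqVneq s2 s4) => [s24|s24].
  by rewrite -s24 in o4; apply: (@opposite_rows_neq r0 r2 r4 _ _ isT sq2 o2 o4).
have s34 : s3 = s4.
  move: s2ab s3ab s4ab s23 s24; rewrite !inE.
  by do 3![case/orP => /eqP->]; rewrite ?eqxx.
by rewrite -s34 in o4; apply: (@opposite_rows_neq r0 r3 r4 _ _ isT sq3 o3 o4).
Qed.

End HadamardFive.

(** * Characters and tilings *)

Section Characters.

Variable G : finZmodType.
Implicit Types (A T : {set G}) (chi psi : {ffun G -> algC}).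

(** Translation by x permutes the group and multiplies the nonzero product of all values of [chi] by
    [chi x ^+ #|G|]. *)
Lemma character_expr_card chi x : is_character chi -> chi x ^+ #|G| = 1.
Proof.
case=> chi0 chiD.
have nz y : chi y != 0.
  apply/eqP => y0; have := chiD y (- y).
  by rewrite subrr chi0 y0 mul0r => /eqP; rewrite oner_eq0.
have P0 : \prod_y chi y != 0 by apply/prodf_neq0.
apply: (mulIf P0); rewrite mul1r [RHS](reindex_inj (addrI x)) /=.
under [RHS]eq_bigr do rewrite chiD.
by rewrite big_split /= prodr_const.
Qed.

Lemma norm_character chi x : is_character chi -> `|chi x| = 1.
Proof.
move=> chiP; apply: normC_expr1 (character_expr_card x chiP).
by apply/card_gt0P; exists x.
Qed.

Lemma character_neq0 chi x : is_character chi -> chi x != 0.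
Proof. by move=> chiP; apply/unimodular_neq0/norm_character. Qed.

Lemma characterB chi x y : is_character chi -> chi (x - y) = chi x / chi y.
Proof.
move=> chiP; apply: (mulIf (character_neq0 y chiP)); case: (chiP) => _ <-.
by rewrite mulfVK ?subrK // character_neq0.
Qed.

Definition quotient_character chi psi : {ffun G -> algC} :=
  [ffun x => chi x / psi x].

Lemma quotient_characterP chi psi : is_character chi -> is_character psi ->
  is_character (quotient_character chi psi).
Proof.
move=> chiP psiP; split; first by rewrite ffunE chiP.1 psiP.1 divr1.
by move=> x y; rewrite !ffunE chiP.2 psiP.2 invfM mulrACA.
Qed.

Lemma tiles_of_transversal A T :
  (forall x, exists a, [/\ a \in A, x - a \in T &
    forall b, b \in A -> x - b \in T -> b = a]) -> tiles A.
Proof.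
move=> AT; exists T => x; have [a [aA xaT uniq_a]] := AT x.
rewrite (bigD1 (x - a)) //= opprB addrC subrK aA big1 // => t /andP[tT tx].
apply/eqP; rewrite eqb0; apply: contra tx => xtA.
by rewrite -(uniq_a _ xtA) opprB addrC subrK.
Qed.

Lemma mem_all_roots (F : fieldType) (s : seq F) p c z :
  (0 < p)%N -> uniq s -> size s = p -> {in s, forall y, y ^+ p = c} ->
  z ^+ p = c -> z \in s.
Proof.
move=> p0 us ss sc zc; apply/negPn/negP => zs.
have P0 : 'X^p - c%:P != 0 :> {poly F} by rewrite -size_poly_eq0 size_XnsubC.
have := @max_poly_roots _ _ (z :: s) P0; rewrite size_XnsubC //= zs us ss ltnn.
suff -> : root ('X^p - c%:P) z && all (root ('X^p - c%:P)) s by move/(_ isT isT).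
rewrite /root !hornerE zc subrr eqxx.
by apply/allP => y ys; rewrite /root !hornerE sc // subrr.
Qed.

(* The complement is the preimage under [chi] of the fundamental domain
   [z = p.-root (z ^+ p)] of the p-th power map. *)
Lemma tiles_of_coset chi A : is_character chi -> (0 < #|A|)%N ->
  {in A &, injective chi} ->
  {in A &, forall a b, chi a ^+ #|A| = chi b ^+ #|A|} -> tiles A.
Proof.
move=> chiP A0 inj cst; set p := #|A| in A0 cst *.
apply: (@tiles_of_transversal _ [set t | p.-root (chi t ^+ p) == chi t]) => x.
have nz y := character_neq0 y chiP.
have /card_gt0P[a0 a0A] := A0.
pose y := p.-root (chi (x - a0) ^+ p).
have yp : y ^+ p = chi (x - a0) ^+ p by rewrite rootCK.
have xE a : a \in A -> chi (x - a) ^+ p = chi (x - a0) ^+ p.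
  by move=> aA; rewrite !characterB // !exprMn !exprVn (cst a a0).
(* The values [chi (x - a)] are p distinct solutions of Y^p = chi (x - a0)^p, hence all of them,
   including the chosen root [y]. *)
have /mapP[a] : y \in [seq chi (x - a) | a <- enum A].
  apply: (@mem_all_roots _ _ p _ _ A0 _ _ _ yp).
  - rewrite map_inj_in_uniq ?enum_uniq // => a b; rewrite !mem_enum => aA bA.
    by rewrite !characterB // => /(mulfI (nz x))/invr_inj; apply: inj.
  - by rewrite size_map -cardE.
  - by move=> _ /mapP[a + ->]; rewrite mem_enum => /xE.
rewrite mem_enum => aA yE; exists a; split=> //.
  by rewrite inE (xE a aA) -/y yE.
move=> b bA; rewrite inE (xE b bA) -/y yE !characterB // => /eqP.
by move=> /(mulfI (nz x))/invr_inj/inj ->.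
Qed.

(** A fundamental domain of squaring: a choice of one number from each pair of opposite nonzero
    numbers. *)
Definition principal (z : algC) := sqrtC (z ^+ 2) == z.

Lemma principalN z : z != 0 -> principal (- z) = ~~ principal z.
Proof.
move=> z0; rewrite /principal sqrrN.
have zN : (z == - z) = false by rewrite -subr_eq0 opprK -mulr2n mulrn_eq0 (negPf z0).
have /eqP := sqrtCK (z ^+ 2); rewrite -subr_eq0 subr_sqr mulf_eq0.
by rewrite subr_eq0 addr_eq0 => /orP[]/eqP ->; rewrite eqxx ?zN // eq_sym zN.
Qed.

(** Requiring both values at x - y to be principal singles out one y in A: [psi] selects the half
    {a, b} or {c, d}, then [chi] selects the element in it. *)
Lemma tiles_of_two_characters chi psi A a b c d :
  is_character chi -> is_character psi -> A =i [:: a; b; c; d] ->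
  psi a = psi b -> psi c = psi d -> psi a + psi c = 0 ->
  chi a + chi b = 0 -> chi c + chi d = 0 -> tiles A.
Proof.
move=> chiP psiP AE pab pcd pac cab ccd.
apply: (@tiles_of_transversal _
  [set t | principal (psi t) && principal (chi t)]) => x.
have divN (u v w : algC) : v + w = 0 -> u / w = - (u / v).
  by move/eqP; rewrite addr_eq0 => /eqP ->; rewrite invrN mulrN opprK.
have nz theta y : is_character theta -> theta x / theta y != 0.
  by move=> tP; rewrite -characterB // character_neq0.
have mE y : (x - y \in [set t | principal (psi t) && principal (chi t)]) =
    principal (psi x / psi y) && principal (chi x / chi y).
  by rewrite inE !characterB.
have pb : psi x / psi b = psi x / psi a by rewrite pab.
have pc : principal (psi x / psi c) = ~~ principal (psi x / psi a).
  by rewrite (divN _ _ _ pac) principalN ?nz.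
have pd : principal (psi x / psi d) = ~~ principal (psi x / psi a) by rewrite -pcd.
have cb : principal (chi x / chi b) = ~~ principal (chi x / chi a).
  by rewrite (divN _ _ _ cab) principalN ?nz.
have cd : principal (chi x / chi d) = ~~ principal (chi x / chi c).
  by rewrite (divN _ _ _ ccd) principalN ?nz.
pose y := if principal (psi x / psi a)
  then if principal (chi x / chi a) then a else b
  else if principal (chi x / chi c) then c else d.
exists y; rewrite mE; split.
- by rewrite AE /y; do 2!case: ifP => _; rewrite !inE eqxx ?orbT.
- rewrite /y; case: ifP => Pa; case: ifP => Pc; rewrite ?pb ?pc ?pd ?cb ?cd;
    by rewrite Pa Pc.
move=> t; rewrite AE mE !inE => /or4P[]/eqP ->; rewrite ?pb ?pc ?pd ?cb ?cd /y;
  by case: ifP => _; case: ifP => _.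
Qed.

(** The product (x + y)(x + z)(x + t) equals x^2 e1 + e3, where e1 = 0 and e3 is xyzt times the
    conjugate of e1. *)
Lemma four_unimodular_sum0 (x y z t : algC) :
  `|x| = 1 -> `|y| = 1 -> `|z| = 1 -> `|t| = 1 -> x + y + z + t = 0 ->
  [\/ x + y = 0 /\ z + t = 0, x + z = 0 /\ y + t = 0 | x + t = 0 /\ y + z = 0].
Proof.
move=> x1 y1 z1 t1 s0.
have sV : x^-1 + y^-1 + z^-1 + t^-1 = 0.
  by rewrite !invC_unimodular // -!rmorphD s0 rmorph0.
have : (x + y) * ((x + z) * (x + t)) = 0.
  have -> : (x + y) * ((x + z) * (x + t)) =
     x ^+ 2 * (x + y + z + t) + (x * y * z * t) * (x^-1 + y^-1 + z^-1 + t^-1).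
    by field; rewrite !unimodular_neq0.
  by rewrite s0 sV !mulr0 addr0.
move/eqP; rewrite !mulf_eq0 => /or3P[]/eqP h.
- by apply: Or31; split=> //; rewrite -[RHS](subrr 0) -{1}s0 -h; ring.
- by apply: Or32; split=> //; rewrite -[RHS](subrr 0) -{1}s0 -h; ring.
by apply: Or33; split=> //; rewrite -[RHS](subrr 0) -{1}s0 -h; ring.
Qed.

(** Orthogonality to [u] and [v] is a linear system in w a - w b and w c - w d, nonsingular by [e1].
    Hence [w] is constant on both pairs and separates them, while [u] splits each. *)
Lemma tiles_four_same_pairing (u v w : {ffun G -> algC}) A a b c d :
  is_character u -> is_character v -> is_character w -> A =i [:: a; b; c; d] ->
  u a + u b = 0 -> u c + u d = 0 -> v a + v b = 0 -> v c + v d = 0 ->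
  w a + w b + w c + w d = 0 ->
  u a / v a + u b / v b + u c / v c + u d / v d = 0 ->
  w a / u a + w b / u b + w c / u c + w d / u d = 0 ->
  w a / v a + w b / v b + w c / v c + w d / v d = 0 -> tiles A.
Proof.
move=> uP vP wP AE uab ucd vab vcd sw suv swu swv.
have opp (x y : algC) : x + y = 0 -> y = - x.
  by move/eqP; rewrite addrC addr_eq0 => /eqP.
have nz (theta : {ffun G -> algC}) x : is_character theta -> theta x != 0.
  by move=> tP; apply: character_neq0.
have e1 : u a * v c + u c * v a = 0.
  apply: (mulfI (_ : 2 != 0 :> algC)); first by rewrite pnatr_eq0.
  rewrite mulr0 -[RHS](mulr0 (v a * v c)) -suv (opp _ _ uab) (opp _ _ ucd).
  by rewrite (opp _ _ vab) (opp _ _ vcd); field; rewrite !nz.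
have e2 : (w a - w b) * u c + (w c - w d) * u a = 0.
  rewrite -[RHS](mulr0 (u a * u c)) -swu (opp _ _ uab) (opp _ _ ucd).
  by field; rewrite !nz.
have e3 : (w a - w b) * v c + (w c - w d) * v a = 0.
  rewrite -[RHS](mulr0 (v a * v c)) -swv (opp _ _ vab) (opp _ _ vcd).
  by field; rewrite !nz.
have n2 : 2 != 0 :> algC by rewrite pnatr_eq0.
have wcd : w c = w d.
  apply/eqP; rewrite -subr_eq0; apply/eqP.
  apply: (mulIf (nz u a uP)); apply: (mulIf (nz v a vP)); apply: (mulfI n2).
  have -> : 2 * ((w c - w d) * u a * v a) =
    v a * ((w a - w b) * u c + (w c - w d) * u a) +
    u a * ((w a - w b) * v c + (w c - w d) * v a) -
    (w a - w b) * (u a * v c + u c * v a) by ring.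
  by rewrite e1 e2 e3 !(mulr0, mul0r) addr0 subr0.
have wab : w a = w b.
  apply/eqP; rewrite -subr_eq0; apply/eqP/(mulIf (nz u c uP)).
  by rewrite mul0r -e2 wcd subrr mul0r addr0.
apply: (tiles_of_two_characters uP wP AE) => //.
by apply: (mulfI n2); rewrite mulr0 -sw -wab -wcd; ring.
Qed.

(** Orthogonality of [u] and [v] factors as (u a - u c)(v b - v a) = 0; either factor makes one
    character constant on the pairs that the other one splits. *)
Lemma tiles_four_distinct_pairings (u v : {ffun G -> algC}) A a b c d :
  is_character u -> is_character v -> A =i [:: a; b; c; d] ->
  u a + u b = 0 -> u c + u d = 0 -> v a + v c = 0 -> v b + v d = 0 ->
  u a / v a + u b / v b + u c / v c + u d / v d = 0 -> tiles A.
Proof.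
move=> uP vP AE uab ucd vac vbd suv.
have opp (x y : algC) : x + y = 0 -> y = - x.
  by move/eqP; rewrite addrC addr_eq0 => /eqP.
have nz (theta : {ffun G -> algC}) x : is_character theta -> theta x != 0.
  by move=> tP; apply: character_neq0.
have : (u a - u c) * (v b - v a) = 0.
  rewrite -[RHS](mulr0 (v a * v b)) -suv (opp _ _ uab) (opp _ _ ucd).
  by rewrite (opp _ _ vac) (opp _ _ vbd); field; rewrite !nz.
move/eqP; rewrite mulf_eq0 !subr_eq0 => /orP[]/eqP E; last first.
  apply: (tiles_of_two_characters uP vP AE) => //.
  by rewrite (opp _ _ vac) (opp _ _ vbd) E.
have AE' : A =i [:: a; c; b; d].
  by move=> x; rewrite AE !inE; congr orb; rewrite orbCA.
apply: (tiles_of_two_characters vP uP AE') => //.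
by rewrite (opp _ _ uab) (opp _ _ ucd) E.
Qed.

(** Conjugates become inverses because characters are unimodular, which turns orthogonality into a
    field identity. *)
Lemma spectral_matrix A n : #|A| = n -> spectral A ->
  exists (l : 'I_n -> {ffun G -> algC}) (e : 'I_n -> G),
  [/\ forall i, is_character (l i), A =i codom e &
    forall i j, i != j -> \sum_a l i (e a) / l j (e a) = 0].
Proof.
move=> cA [L [uL sL charL orthL]]; rewrite cA in sL.
have sE : size (enum A) = n by rewrite -cardE.
pose l (i : 'I_n) := nth [ffun=> 1] L i.
pose e (i : 'I_n) := nth 0 (enum A) i.
have lL i : l i \in L by rewrite mem_nth ?sL.
have AE : A =i codom e.
  move=> x; rewrite -mem_enum; apply/idP/codomP => [xA|[i ->]].
    have xi : (index x (enum A) < n)%N by rewrite -sE index_mem.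
    by exists (Ordinal xi); rewrite /e nth_index.
  by rewrite mem_nth ?sE.
exists l, e; split=> // [i|i j ij].
  exact: charL.
have lij : l i != l j by rewrite nth_uniq ?sL.
rewrite -[RHS](orthL _ _ (lL i) (lL j) lij) /innerA -[RHS]big_enum.
rewrite [RHS](big_nth 0) sE big_mkord; apply: eq_bigr => a _.
by rewrite invC_unimodular //; apply/norm_character/charL.
Qed.

Lemma tiles_of_coset_row A n (l : 'I_n -> {ffun G -> algC}) (e : 'I_n -> G) i j :
  (forall i, is_character (l i)) -> A =i codom e -> #|A| = n -> (0 < n)%N ->
  injective (fun a => l i (e a) / l j (e a)) ->
  (forall a b, (l i (e a) / l j (e a)) ^+ n = (l i (e b) / l j (e b)) ^+ n) ->
  tiles A.
Proof.
move=> lP AE cA n0 inj cst.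
apply: (tiles_of_coset (quotient_characterP (lP i) (lP j))); rewrite ?cA //.
  move=> x y; rewrite !AE => /codomP[a ->] /codomP[b ->].
  by rewrite !ffunE => /inj ->.
by move=> x y; rewrite !AE => /codomP[a ->] /codomP[b ->]; rewrite !ffunE.
Qed.

End Characters.

(** * Spectral sets of each order from 1 to 5 *)

Section SmallSpectralSets.

Variables (G : finZmodType) (A : {set G}).
Hypothesis specA : spectral A.

Lemma tiles_card1 : #|A| = 1%N -> tiles A.
Proof.
move=> cA; have /eqP/cards1P[a AE] := cA.
have trivP : is_character [ffun _ : G => 1 : algC].
  by split=> [|x y]; rewrite !ffunE ?mul1r.
apply: (tiles_of_coset trivP); rewrite ?cA // => x y.
  by rewrite AE !inE => /eqP -> /eqP ->.
by rewrite !ffunE.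
Qed.

Lemma tiles_card2 : #|A| = 2 -> tiles A.
Proof.
move=> cA; have [l [e [lP AE orth]]] := spectral_matrix cA specA.
have := orth ord0 ord_max isT; set z := fun a => l ord0 (e a) / l ord_max (e a).
rewrite (eq_bigr z) // !big_ord_recl big_ord0 addr0 => /eqP.
rewrite addr_eq0 => /eqP z01.
have z0 a : z a != 0 by rewrite mulf_neq0 ?invr_eq0 ?character_neq0.
pose a0 : 'I_2 := ord0; pose a1 : 'I_2 := lift ord0 ord0.
have I2 (a : 'I_2) : a = a0 \/ a = a1.
  by case: a => [[|[|//]] lt]; [left|right]; apply: val_inj.
have zne : z a1 != - z a1.
  by rewrite -subr_eq0 opprK -mulr2n mulrn_eq0 (negPf (z0 _)).
apply: (tiles_of_coset_row (i := ord0) (j := ord_max) lP AE cA) => //.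
  move=> a b; rewrite -/(z a) -/(z b).
  case: (I2 a) (I2 b) => -> [] -> //; rewrite z01 => /eqP.
    by rewrite eq_sym (negPf zne).
  by rewrite (negPf zne).
move=> a b; rewrite -/(z a) -/(z b).
by case: (I2 a) (I2 b) => -> [] -> //; rewrite z01 sqrrN.
Qed.

Lemma tiles_card3 : #|A| = 3 -> tiles A.
Proof.
move=> cA; have [l [e [lP AE orth]]] := spectral_matrix cA specA.
have := orth ord0 ord_max isT; set z := fun a => l ord0 (e a) / l ord_max (e a).
rewrite (eq_bigr z) // => sz.
have z1 a : `|z a| = 1 by rewrite normrM normfV !norm_character // invr1 mulr1.
have z0 a := unimodular_neq0 (z1 a).
pose a0 : 'I_3 := ord0; pose a1 : 'I_3 := lift ord0 ord0.
pose a2 : 'I_3 := lift ord0 (lift ord0 ord0).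
have [||w [ew w1 w2]] := @sum3_inv_sum3 _ (z a0) (z a1) (z a2) (z0 _) (z0 _) (z0 _).
- by rewrite -addrA -[RHS]sz !big_ord_recl big_ord0 addr0.
- rewrite -addrA -[RHS](sum_inv_normC z1 sz) !big_ord_recl big_ord0 addr0 //.
have w3 : w ^+ 3 = 1.
  apply/eqP; rewrite -subr_eq0; apply/eqP.
  by rewrite -[RHS](mulr0 (w - 1)) -ew; ring.
have w_neq1 : w != 1.
  apply/eqP => w_1; move: ew; rewrite w_1 expr1n.
  have -> : 1 + 1 + 1 = 3 :> algC by ring.
  by move/eqP; rewrite pnatr_eq0.
have pw : 3.-primitive_root w.
  have [m pm m3] := prim_order_exists (isT : 0 < 3)%N w3.
  case: m pm m3 (dvdn_leq (isT : 0 < 3)%N m3) => [|[|[|[|m]]]] // pm _ _.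
  by case/eqP: w_neq1; rewrite -[LHS]expr1 (prim_expr_order pm).
have zE (a : 'I_3) : z a = w ^+ a * z a0.
  case: a => [[|[|[|//]]] lt].
  - by rewrite mul1r; congr z; apply: val_inj.
  - by rewrite -w1; congr z; apply: val_inj.
  - by rewrite -w2; congr z; apply: val_inj.
apply: (tiles_of_coset_row (i := ord0) (j := ord_max) lP AE cA) => //.
  move=> a b; rewrite -/(z a) -/(z b) (zE a) (zE b) => /(mulIf (z0 _))/eqP.
  by rewrite (eq_prim_root_expr pw) !modn_small // => /eqP/val_inj.
move=> a b; rewrite -/(z a) -/(z b) (zE a) (zE b) !exprMn -!exprM.
by rewrite ![(_ * 3)%N]mulnC !exprM w3 !expr1n.
Qed.

(** After division by row 0 each other row sums to 0 on A and so pairs its elements. The pairings of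
    rows 1 and 2 are either equal, when row 3 supplies the second splitting, or distinct. *)
Lemma tiles_card4 : #|A| = 4 -> tiles A.
Proof.
move=> cA; have [l [e [lP AE orth]]] := spectral_matrix cA specA.
pose i0 : 'I_4 := ord0; pose i1 : 'I_4 := lift ord0 ord0.
pose i2 : 'I_4 := lift ord0 (lift ord0 ord0).
pose i3 : 'I_4 := lift ord0 (lift ord0 (lift ord0 ord0)).
have I4 (a : 'I_4) : [\/ a = i0, a = i1, a = i2 | a = i3].
  by case: a => [[|[|[|[|//]]]] lt];
    [apply: Or41|apply: Or42|apply: Or43|apply: Or44]; apply: val_inj.
pose s := [:: e i0; e i1; e i2; e i3].
pose u i := quotient_character (l i) (l i0).
have uP i : is_character (u i) by apply: quotient_characterP.
have As : A =i s.
  move=> x; rewrite AE; apply/codomP/idP => [[a ->]|].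
    by case: (I4 a) => ->; rewrite !inE eqxx ?orbT.
  by rewrite !inE => /or4P[]/eqP ->; [exists i0|exists i1|exists i2|exists i3].
have sumE (F : G -> algC) : \sum_i F (e i) = \sum_(x <- s) F x.
  by rewrite !big_ord_recl big_ord0 !big_cons big_nil.
have su i : i != i0 -> \sum_(x <- s) u i x = 0.
  move=> ii0; rewrite -sumE -[RHS](orth i i0 ii0).
  by apply: eq_bigr => a _; rewrite ffunE.
have suv i j : i != j -> \sum_(x <- s) u i x / u j x = 0.
  move=> ij; rewrite -(sumE (fun x => u i x / u j x)) -[RHS](orth i j ij).
  by apply: eq_bigr => a _; rewrite !ffunE; field; rewrite !character_neq0.
have perm4 (F : G -> algC) a b c d : perm_eq [:: a; b; c; d] s ->
    \sum_(x <- s) F x = 0 -> F a + F b + F c + F d = 0.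
  by move=> /(perm_big _) <-; rewrite !big_cons big_nil /= addr0 !addrA.
have memA a b c d : perm_eq [:: a; b; c; d] s -> A =i [:: a; b; c; d].
  by move=> p x; rewrite As (perm_mem p).
have distinct a b c d : perm_eq [:: a; b; c; d] s ->
    u i1 a + u i1 b = 0 -> u i1 c + u i1 d = 0 ->
    u i2 a + u i2 c = 0 -> u i2 b + u i2 d = 0 -> tiles A.
  move=> p ab cd ac bd.
  apply: (tiles_four_distinct_pairings (uP i1) (uP i2) (memA _ _ _ _ p)) => //.
  exact: (perm4 (fun x => u i1 x / u i2 x) _ _ _ _ p (suv i1 i2 isT)).
have same a b c d : perm_eq [:: a; b; c; d] s ->
    u i1 a + u i1 b = 0 -> u i1 c + u i1 d = 0 ->
    u i2 a + u i2 b = 0 -> u i2 c + u i2 d = 0 -> tiles A.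
  move=> p ab cd ab' cd'.
  apply: (tiles_four_same_pairing (uP i1) (uP i2) (uP i3) (memA _ _ _ _ p)) => //.
  - exact: (perm4 (u i3) _ _ _ _ p (su i3 isT)).
  - exact: (perm4 (fun x => u i1 x / u i2 x) _ _ _ _ p (suv i1 i2 isT)).
  - exact: (perm4 (fun x => u i3 x / u i1 x) _ _ _ _ p (suv i3 i1 isT)).
  - exact: (perm4 (fun x => u i3 x / u i2 x) _ _ _ _ p (suv i3 i2 isT)).
have pairing i : i != i0 ->
    [\/ u i (e i0) + u i (e i1) = 0 /\ u i (e i2) + u i (e i3) = 0,
        u i (e i0) + u i (e i2) = 0 /\ u i (e i1) + u i (e i3) = 0
      | u i (e i0) + u i (e i3) = 0 /\ u i (e i1) + u i (e i2) = 0].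
  move=> ii0; apply: four_unimodular_sum0; rewrite ?norm_character //.
  exact: (perm4 (u i) _ _ _ _ (perm_refl s) (su i ii0)).
have addC (x y : algC) : x + y = 0 -> y + x = 0 by rewrite addrC.
have [[p1 p2]|[p1 p2]|[p1 p2]] := pairing i1 isT;
have [[q1 q2]|[q1 q2]|[q1 q2]] := pairing i2 isT.
- by apply: (same (e i0) (e i1) (e i2) (e i3)).
- by apply: (distinct (e i0) (e i1) (e i2) (e i3)).
- apply: (distinct (e i0) (e i1) (e i3) (e i2)) => //; last exact: addC.
  by apply/permP => P /=; ring.
- apply: (distinct (e i0) (e i2) (e i1) (e i3)) => //.
  by apply/permP => P /=; ring.
- apply: (same (e i0) (e i2) (e i1) (e i3)) => //.
  by apply/permP => P /=; ring.
- apply: (distinct (e i0) (e i2) (e i3) (e i1)) => //; try exact: addC.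
  by apply/permP => P /=; ring.
- apply: (distinct (e i0) (e i3) (e i1) (e i2)) => //; try exact: addC.
  by apply/permP => P /=; ring.
- apply: (distinct (e i0) (e i3) (e i2) (e i1)) => //; try exact: addC.
  by apply/permP => P /=; ring.
apply: (same (e i0) (e i3) (e i1) (e i2)) => //.
by apply/permP => P /=; ring.
Qed.

Lemma tiles_card5 : #|A| = 5 -> tiles A.
Proof.
move=> cA; have [l [e [lP AE orth]]] := spectral_matrix cA specA.
pose H i a := l i (e a).
have H1 i a : `|H i a| = 1 by apply: norm_character.
have [i [j [ij noopp]]] : exists i j, i != j /\
    forall a b, a != b -> ~ opposite H i j a b.
  case: (boolP [exists i, exists j, (i != j) && [forall a, forall b, (a != b) ==>
     (H i a * H j b + H i b * H j a != 0)]]) => [|no].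
    case/existsP => i /existsP[j /andP[ij /forallP noopp]].
    exists i, j; split=> // a b ab; apply/eqP.
    by move/forallP/(_ b): (noopp a); rewrite ab.
  case: (not_all_opposite H1 orth) => i j ij.
  move: no; rewrite negb_exists => /forallP/(_ i).
  rewrite negb_exists => /forallP/(_ j); rewrite ij /=.
  rewrite negb_forall => /existsP[a]; rewrite negb_forall => /existsP[b].
  by rewrite negb_imply negbK => /andP[ab /eqP o]; exists a, b.
pose z a := H j a / H i a.
have z0 a : z a != 0 by rewrite mulf_neq0 ?invr_eq0 ?character_neq0.
(* Dividing by the first value gives the normalisation that [five_roots_of_unity] requires; [#|G|]
   serves as common exponent. *)
pose y a := z a / z ord0.
have y0 a : y a != 0 by rewrite mulf_neq0 ?invr_eq0.
have sy : \sum_a y a = 0.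
  by rewrite -mulr_suml (sum_quotient orth ij) mul0r.
have zopp a b : z a + z b != 0.
  case: (eqVneq a b) => [->|ab]; first by rewrite -mulr2n mulrn_eq0 (negPf (z0 b)).
  by apply/eqP => /(opposite_quotient H1); apply: noopp.
have yopp a b : y a + y b != 0 by rewrite -mulrDl mulf_neq0 ?invr_eq0.
have yG a : y a ^+ #|G| = 1.
  have zG b : z b ^+ #|G| = 1.
    by rewrite exprMn exprVn !character_expr_card // divr1.
  by rewrite exprMn exprVn !zG divr1.
have G0 : (0 < #|G|)%N by apply/card_gt0P; exists 0.
have [yinj y5] := five_roots_of_unity y0 sy yopp G0 (divff (z0 _)) yG.
apply: (tiles_of_coset_row (i := j) (j := i) lP AE cA) => //.
  by move=> a b zab; apply: yinj; rewrite /y /z /H zab.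
have zE a : z a ^+ 5 = z ord0 ^+ 5.
  by rewrite -[z a](mulfVK (z0 ord0)) exprMn y5 mul1r.
by move=> a b; rewrite -/(z a) -/(z b) !zE.
Qed.

End SmallSpectralSets.

Theorem theorem2p1 (G : finZmodType) (A : {set G}) :
  (0 < #|A|)%N -> (#|A| <= 5)%N -> spectral A -> tiles A.
Proof.
move=> A0 A5 specA.
have : #|A| \in [:: 1; 2; 3; 4; 5]%N by move: A0 A5; case: #|A| => [|[|[|[|[|[|]]]]]].
rewrite !inE => /or4P[/eqP|/eqP|/eqP|/orP[]/eqP].
- exact: tiles_card1.
- exact: tiles_card2.
- exact: tiles_card3.
- exact: tiles_card4.
- exact: tiles_card5.
Qed.
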